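(* Let $(X,\Sigma_X,\mu)$ and $(Y,\Sigma_Y,\nu)$ be measure spaces such that the pair $(\mu,\nu)$ is abelian. If $u\in L^1(X\times Y,\mu\otimes\nu)$, then the sections of $u$ are almost everywhere integrable (that is, $u(x,\cdot)$ is $\nu$-integrable for $\mu$-almost every $x\in X$, and $u(\cdot,y)$ is $\mu$-integrable for $\nu$-almost every $y\in Y$), and $$\int_{X\times Y} u\,d(\mu\otimes\nu)=\int_X\left(\int_Y u(x,y)\,d\nu(y)\right)d\mu(x)=\int_Y\left(\int_X u(x,y)\,d\mu(x)\right)d\nu(y).$$
   Context: No finiteness or $\sigma$-finiteness assumptions are made on the measures. $\Sigma_X\otimes\Sigma_Y$ denotes the $\sigma$-algebra on $X\times Y$ generated by the measurable rectangles $E\times F$ with $E\in\Sigma_X$, $F\in\Sigma_Y$. For $A\subseteq X\times Y$, write $A^y=\{x\in X\mid (x,y)\in A\}$ and $A_x=\{y\in Y\mid (x,y)\in A\}$. The pair $(\mu,\nu)$ is called abelian if for every $A\in\Sigma_X\otimes\Sigma_Y$: (i) $y\mapsto\mu(A^y)$ is $\Sigma_Y$-measurable; (ii) $x\mapsto\nu(A_x)$ is $\Sigma_X$-measurable; (iii) $\int_Y\mu(A^y)\,d\nu(y)=\int_X\nu(A_x)\,d\mu(x)$ (as elements of $[0,+\infty]$). For an abelian pair $(\mu,\nu)$ the product measure $\mu\otimes\nu$ on $\Sigma_X\otimes\Sigma_Y$ is defined by $(\mu\otimes\nu)(A)=\int_X\nu(A_x)\,d\mu(x)=\int_Y\mu(A^y)\,d\nu(y)$;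 it is a measure. $u\in L^1(X\times Y,\mu\otimes\nu)$ means that $u$ is a real-valued, $(\Sigma_X\otimes\Sigma_Y)$-measurable function with $\int_{X\times Y}|u|\,d(\mu\otimes\nu)<\infty$. As usual, the inner integrals, which are defined only almost everywhere, are assigned the value $0$ at the exceptional points where the section is not integrable. *)

(* Defs.v *)
From HB Require Import structures.
From mathcomp Require Import all_boot all_order all_algebra.
From mathcomp Require Import all_classical all_reals all_analysis.
From mathcomp Require Import measurable_realfun.

Set Implicit Arguments.
Unset Strict Implicit.
Unset Printing Implicit Defensive.

Import Order.TTheory GRing.Theory Num.Theory.
Import numFieldNormedType.Exports.

Local Open Scope classical_set_scope.
Local Open Scope ring_scope.
Local Open Scope ereal_scope.

(* [ysection A y] is the paper's A^y and [xsection A x] is its A_x. The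
   sigma-algebra on X * Y is the one generated by the measurable rectangles,
   see [measurable_prod_measurableType]. *)
Definition abelian_pair (d1 d2 : measure_display) (X : measurableType d1)
    (Y : measurableType d2) (R : realType)
    (mu : {measure set X -> \bar R}) (nu : {measure set Y -> \bar R}) : Prop :=
  forall A : set (X * Y), measurable A ->
    [/\ measurable_fun [set: Y] (fun y => mu (ysection A y)),
        measurable_fun [set: X] (fun x => nu (xsection A x)) &
        \int[nu]_y mu (ysection A y) = \int[mu]_x nu (xsection A x)].

Section abelian_product.
Context (d1 d2 : measure_display) (X : measurableType d1)
  (Y : measurableType d2) (R : realType).
Variables (mu : {measure set X -> \bar R}) (nu : {measure set Y -> \bar R}).

(* The library makes [mu \x nu] a measure only for sigma-finite [nu]. The unused
   argument of type [abelian_pair mu nu] replaces that assumption. *)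
Definition abelian_product of abelian_pair mu nu : set (X * Y) -> \bar R :=
  fun A => \int[mu]_x nu (xsection A x).

Lemma abelian_productE2 (ab : abelian_pair mu nu) (A : set (X * Y)) :
  measurable A -> abelian_product ab A = \int[nu]_y mu (ysection A y).
Proof. by move=> mA; have [_ _ ->] := ab A mA. Qed.

Variable ab : abelian_pair mu nu.

Let product0 : abelian_product ab set0 = 0.
Proof. by apply: integral0_eq => x _; rewrite xsection0 measure0. Qed.

Let product_ge0 A : 0 <= abelian_product ab A.
Proof. by apply: integral_ge0 => x _; exact: measure_ge0. Qed.

Let product_sigma_additive : semi_sigma_additive (abelian_product ab).
Proof.
move=> F mF tF mUF.
rewrite [X in _ --> X](_ : _ = \sum_(n <oo) abelian_product ab (F n)).
  by apply/cvg_closeP; split; [exact: is_cvg_nneseries|rewrite closeE].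
rewrite /abelian_product -integral_nneseries//; last first.
  by move=> n; have [] := ab (mF n).
apply: eq_integral => x _; apply/esym/cvg_lim => //=; rewrite xsection_bigcup.
apply: (measure_sigma_additive _ (trivIset_xsection tF)) => n.
exact: measurable_xsection.
Qed.

HB.instance Definition _ := isMeasure.Build _ _ _ (abelian_product ab)
  product0 product_ge0 product_sigma_additive.

End abelian_product.

(* The integral of [f], set to 0 when [f] is not integrable. The test is needed
   because the library's integral may be infinite for a measurable function that
   is not integrable. *)
Definition integral_or0 (d : measure_display) (T : measurableType d)
    (R : realType) (m : {measure set T -> \bar R}) (f : T -> R) : \bar R :=
  if m.-integrable [set: T] (EFin \o f) then \int[m]_t (f t)%:E else 0.

(* Main.v *)
(* Write [k x] for the image of [nu] under [y |-> (x, y)]. Being abelian says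
   exactly that [x |-> k x A] is measurable and that the product measure [m]
   satisfies [m A = \int[mu]_x k x A]; symmetrically for the images of [mu] under
   [x |-> (x, y)]. Both halves of the theorem are thus instances of one statement
   about a measure [m] disintegrated as [m A = \int[mu]_x k x A], for which the
   passage from sets to simple functions, nonnegative functions and integrable
   functions needs no finiteness assumption. *)
Require Import Defs.
From HB Require Import structures.
From mathcomp Require Import all_boot all_order all_algebra.
From mathcomp Require Import all_classical all_reals all_analysis.
From mathcomp Require Import measurable_realfun.

Local Open Scope classical_set_scope.
Local Open Scope ring_scope.
Local Open Scope ereal_scope.

Section disintegration.
Context {d d' : measure_display} {X : measurableType d} {T : measurableType d'}
  {R : realType} {mu : {measure set X -> \bar R}}
  {k : X -> {measure set T -> \bar R}} {m : {measure set T -> \bar R}}.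
Hypothesis mk : forall A, measurable A -> measurable_fun [set: X] (k ^~ A).
Hypothesis mE : forall A, measurable A -> m A = \int[mu]_x k x A.

Import HBNNSimple.

(** Both integrals reduce to finite sums over the values of [f]: such a sum of nonnegative functions
    commutes with the integral over [mu], and [mE] applies to each level set. *)
Lemma nnsfun_integral_disintegration (f : {nnsfun T >-> R}) :
  \int[m]_t (f t)%:E = \int[mu]_x \int[k x]_t (f t)%:E.
Proof.
have fE (l : {measure set T -> \bar R}) : \int[l]_t (f t)%:E =
    \sum_(r \in range f) r%:E * l (f @^-1` [set r]).
  by rewrite integralT_nnsfun sintegralE.
rewrite fE; under eq_integral do rewrite fE.
rewrite ge0_integral_fsum//; last 2 first.
- by move=> r; exact/measurable_funeM/mk.
(* A negative [r] is harmless: its preimage is empty, so the product is 0. *)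
- by move=> r x _; apply: (mulemu_ge0 (fun r => f @^-1` [set r]));
     exact: preimage_nnfun0.
apply: eq_fsbigr => r; rewrite inE => -[t _ <-{r}].
by rewrite ge0_integralZl ?lee_fin// ?mE//; exact: mk.
Qed.

(** Monotone convergence along the simple approximations [g n], used for [m], for each [k x], and
    once more for [mu]. *)
Lemma ge0_integral_disintegration (f : T -> \bar R) :
  measurable_fun [set: T] f -> (forall t, 0 <= f t) ->
  \int[m]_t f t = \int[mu]_x \int[k x]_t f t.
Proof.
move=> mf f0; pose g := nnsfun_approx measurableT mf.
have mg n : measurable_fun [set: T] (fun t => (g n t)%:E).
  exact/measurable_EFinP.
have ndg t : {homo (fun n => (g n t)%:E) : a b / (a <= b)%N >-> a <= b}.
  by move=> a b ab; rewrite lee_fin; exact/lefP/nd_nnsfun_approx.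
have fE (l : {measure set T -> \bar R}) :
    \int[l]_t f t = limn (fun n => \int[l]_t (g n t)%:E).
  rewrite -monotone_convergence//; last by move=> n t _; rewrite lee_fin.
  by apply: eq_integral => t _; apply/esym/cvg_lim => //; exact: cvg_nnsfun_approx.
rewrite fE; under eq_integral do rewrite fE.
rewrite monotone_convergence//.
- by under eq_fun do rewrite nnsfun_integral_disintegration.
- move=> n; apply: measurable_fun_integral_kernel => // t.
  by rewrite lee_fin.
- by move=> n x _; apply: integral_ge0 => t _; rewrite lee_fin.
- move=> x _ a b ab; apply: ge0_le_integral => //.
  + by move=> t _; rewrite lee_fin.
  + by move=> t _; exact: ndg.
Qed.

Context {f : T -> R}.
Hypothesis intf : m.-integrable [set: T] (EFin \o f).

Let mf : measurable_fun [set: T] (EFin \o f).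
Proof. exact: measurable_int intf. Qed.

(** The L1 norm of [f] under [k x]. Its integral over [mu] is that of [|f|] over [m], hence finite;
    so [N] is finite almost everywhere and serves below as an integrable majorant. *)
Let N x := \int[k x]_t `|(f t)%:E|.

Let N_ge0 x : 0 <= N x. Proof. exact: integral_ge0. Qed.

Let mN : measurable_fun [set: X] N.
Proof. by apply: measurable_fun_integral_kernel => //; exact: measurableT_comp. Qed.

Let intN : mu.-integrable [set: X] N.
Proof.
apply/integrableP; split=> //; under eq_integral do rewrite gee0_abs//.
rewrite -ge0_integral_disintegration//; last exact: measurableT_comp.
by have /integrableP[] := intf.
Qed.

Let integrableE x :
  (k x).-integrable [set: T] (EFin \o f) = (N x \is a fin_num).
Proof.
rewrite ge0_fin_numE//; apply/idP/idP => [/integrableP[]//|Nx].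
exact/integrableP.
Qed.

Lemma ae_integrable_disintegration :
  {ae mu, forall x, (k x).-integrable [set: T] (EFin \o f)}.
Proof.
have := integrable_ae measurableT intN.
by apply: filterS => x /(_ I); rewrite integrableE.
Qed.

(** Since [|f|] is the sum of the positive and negative parts of [f], both [P] and [M] are bounded
    by [N], hence integrable. *)
Let P x := \int[k x]_t (EFin \o f)^\+ t.
Let M x := \int[k x]_t (EFin \o f)^\- t.

Let intP : mu.-integrable [set: X] P.
Proof.
apply: le_integrable intN => //.
  by apply: measurable_fun_integral_kernel => //; exact: measurable_funepos.
move=> x _; rewrite !gee0_abs ?integral_ge0//.
apply: ge0_le_integral => //; [exact: measurable_funepos|exact: measurableT_comp|].
by move=> t _; rewrite -/((abse \o (EFin \o f)) t) fune_abse leeDl.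
Qed.

Let intM : mu.-integrable [set: X] M.
Proof.
apply: le_integrable intN => //.
  by apply: measurable_fun_integral_kernel => //; exact: measurable_funeneg.
move=> x _; rewrite !gee0_abs ?integral_ge0//.
apply: ge0_le_integral => //; [exact: measurable_funeneg|exact: measurableT_comp|].
by move=> t _; rewrite -/((abse \o (EFin \o f)) t) fune_abse leeDr.
Qed.

(** An almost everywhere identity would not give measurability, as [mu] may be incomplete. Cutting
    [P \- M] off to 0 where [N] is infinite matches the default value, so the identity holds at
    every [x]. *)
Let integral_or0E x : integral_or0 (k x) f =
  ((P \- M) \_ [set x | N x \is a fin_num]) x.
Proof.
rewrite /integral_or0 integrableE patchE.
have [Nx|Nx] := boolP (N x \is a fin_num).
  by rewrite mem_set// [in LHS]integralE.
by rewrite memNset//; exact/negP.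
Qed.

Let measurable_integral_or0 :
  measurable_fun [set: X] (fun x => integral_or0 (k x) f).
Proof.
have mD : measurable [set x | N x \is a fin_num].
  by rewrite -[X in measurable X]setTI; exact: emeasurable_fin_num.
rewrite (funext integral_or0E); apply/(measurable_restrictT _ mD)/measurable_funTS.
by apply: measurable_int; exact: (integrableB measurableT intP intM).
Qed.

Lemma integrable_integral_or0_disintegration :
  mu.-integrable [set: X] (fun x => integral_or0 (k x) f).
Proof.
apply: le_integrable intN => // x _; rewrite [leRHS]gee0_abs//.
rewrite /integral_or0; case: ifP => _; last by rewrite abse0.
exact: le_abse_integral.
Qed.

Lemma integral_disintegration :
  \int[m]_t (f t)%:E = \int[mu]_x integral_or0 (k x) f.
Proof.
rewrite integralE !ge0_integral_disintegration//;
  [|exact: measurable_funeneg|exact: measurable_funepos].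
(* [P] and [M] have finite integrals, so the difference of these is the integral of [P \- M], which
   agrees with [integral_or0] wherever [N] is finite. *)
rewrite -integralB//; apply: ae_eq_integral => //.
  by apply: measurable_int; exact: (integrableB measurableT intP intM).
have := integrable_ae measurableT intN; apply: filterS => x /(_ I) Nx _.
by rewrite integral_or0E patchE mem_set.
Qed.

End disintegration.

(* The library's measure structure on [pushforward mu phi] takes the
   measurability of [phi] as an argument that inference cannot fill in. *)
Definition mpushforward {d d' : measure_display} {X : measurableType d}
    {T : measurableType d'} {R : realType} {phi : X -> T}
    (mphi : measurable_fun [set: X] phi) (mu : {measure set X -> \bar R}) :
    {measure set T -> \bar R} :=
  ltac:(refine (pushforward mu phi : {measure set T -> \bar R}); exact: mphi).

Section integral_or0_pushforward.
Context {d d' : measure_display} {X : measurableType d} {T : measurableType d'}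
  {R : realType} {phi : X -> T}.
Variables (mphi : measurable_fun [set: X] phi) (mu : {measure set X -> \bar R}).
Context {f : T -> R}.
Hypothesis mf : measurable_fun [set: T] (EFin \o f).

Lemma integrable_pushforwardE :
  (pushforward mu phi).-integrable [set: T] (EFin \o f) =
  mu.-integrable [set: X] (EFin \o (f \o phi)).
Proof.
apply/idP/idP => [/integrableP[_ foo]|fphi].
  apply/integrableP; split; first exact: measurableT_comp mf mphi.
  move: foo; rewrite ge0_integral_pushforward//; exact: measurableT_comp.
exact: integrable_pushforward.
Qed.

(** The integrability tests on both sides agree, so the default 0 is taken simultaneously; otherwise
    this is a change of variables. *)
Lemma integral_or0_pushforward :
  integral_or0 (mpushforward mphi mu) f = integral_or0 mu (f \o phi).
Proof.
rewrite /integral_or0 integrable_pushforwardE; case: ifP => // fphi.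
by rewrite integral_pushforward.
Qed.

End integral_or0_pushforward.

Theorem theorem3p6 (d1 d2 : measure_display) (X : measurableType d1)
    (Y : measurableType d2) (R : realType)
    (mu : {measure set X -> \bar R}) (nu : {measure set Y -> \bar R})
    (ab : abelian_pair mu nu) (u : X * Y -> R)
    (u_L1 : (abelian_product ab).-integrable [set: X * Y] (EFin \o u)) :
  let IY := fun x : X => integral_or0 nu (fun y => u (x, y)) in
  let IX := fun y : Y => integral_or0 mu (fun x => u (x, y)) in
  [/\ {ae mu, forall x, nu.-integrable [set: Y] (fun y => (u (x, y))%:E)},
      {ae nu, forall y, mu.-integrable [set: X] (fun x => (u (x, y))%:E)},
      mu.-integrable [set: X] IY /\ nu.-integrable [set: Y] IX,
      \int[abelian_product ab]_z (u z)%:E = \int[mu]_x IY x &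
      \int[mu]_x IY x = \int[nu]_y IX y].
Proof.
move=> IY IX.
have measurable_u : measurable_fun [set: X * Y] (EFin \o u).
  exact: measurable_int u_L1.
pose k1 x := mpushforward (@pair1_measurable _ _ X Y x) nu.
pose k2 y := mpushforward (@pair2_measurable _ _ X Y y) mu.
have mk1 A : measurable A -> measurable_fun [set: X] (k1 ^~ A).
  move=> mA; have [_ + _] := ab A mA.
  by under eq_fun do rewrite xsectionE.
have mk2 A : measurable A -> measurable_fun [set: Y] (k2 ^~ A).
  move=> mA; have [+ _ _] := ab A mA.
  by under eq_fun do rewrite ysectionE.
have k1E A : measurable A -> abelian_product ab A = \int[mu]_x k1 x A.
  by move=> mA; apply: eq_integral => x _; rewrite xsectionE.
(* The equality of the two iterated integrals in [abelian_pair] enters here; for [k1] the formula is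
   the definition of the product. *)
have k2E A : measurable A -> abelian_product ab A = \int[nu]_y k2 y A.
  move=> mA; rewrite abelian_productE2//.
  by apply: eq_integral => y _; rewrite ysectionE.
have IYE : IY = (fun x => integral_or0 (k1 x) u).
  by apply/funext => x; rewrite integral_or0_pushforward.
have IXE : IX = (fun y => integral_or0 (k2 y) u).
  by apply/funext => y; rewrite integral_or0_pushforward.
split.
- have := ae_integrable_disintegration mk1 k1E u_L1; apply: filterS => x.
  by rewrite integrable_pushforwardE//; exact: pair1_measurable.
- have := ae_integrable_disintegration mk2 k2E u_L1; apply: filterS => y.
  by rewrite integrable_pushforwardE//; exact: pair2_measurable.
- rewrite IYE IXE.
  by split; [exact: (integrable_integral_or0_disintegration mk1 k1E u_L1)|
             exact: (integrable_integral_or0_disintegration mk2 k2E u_L1)].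
- by rewrite IYE; exact: (integral_disintegration mk1 k1E u_L1).
- by rewrite IYE IXE -(integral_disintegration mk1 k1E u_L1)
    -(integral_disintegration mk2 k2E u_L1).
Qed.
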